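(* Let $\mathcal{L}=(\mathcal{B},\emptyset,\_)$ be a language with no constants, and let $\Gamma=\Gamma_s\,|\,\Gamma_t$ be a partitioned context. (A) For every $t$ with $\Gamma\vdash t\Leftarrow T$, there are a type $M$ and terms $l,r$ with $\Gamma_s\vdash l:M$ and $\Gamma_t.(x:M)\vdash r:T$ such that $\Gamma\vdash r[l..]\equiv t:T$ and, for all $p\in\{+,-\}$, $M^p\subseteq \Gamma_s^p\cap(\Gamma_t^{\bar p}\cup T^p)$. (B) For every $t$ with $\Gamma\vdash t\Rightarrow T$, either 1. $T^p\subseteq\Gamma_s^p$ for all $p$, and there are a type $M$ and terms $l,r$ with $\Gamma_t\vdash l:M$ and $\Gamma_s.(x:M)\vdash r:T$ such that $\Gamma\vdash r[l..]\equiv t:T$ and $M^p\subseteq \Gamma_s^{\bar p}\cap\Gamma_t^p$ for all $p$; or 2. $T^p\subseteq\Gamma_t^p$ for all $p$, and there are a type $M$ and terms $l,r$ with $\Gamma_s\vdash l:M$ and $\Gamma_t.(x:M)\vdash r:T$ such that $\Gamma\vdash r[l..]\equiv t:T$ and $M^p\subseteq\Gamma_s^p\cap\Gamma_t^{\bar p}$ for all $p$.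
   Context: Simply-typed $\lambda$-calculus with sums over a set $\mathcal{B}$ of base types. Types: $A,B::= b\ (b\in\mathcal{B})\mid \top\mid A\times B\mid A\to B\mid \bot\mid A+B$. Contexts are finite lists of typed variables. Terms: variables, $\star$, $(t,u)$, $\pi_1 t,\pi_2 t$, $\lambda x.t$, $t\,u$, $\mathrm{raise}\,t$, $\mathrm{inl}\,t$, $\mathrm{inr}\,t$, $\mathrm{case}\ s\ (x.b_l)\ (x.b_r)$, with the usual typing $\Gamma\vdash t:A$ ($\mathrm{raise}\,t:A$ for any $A$ if $t:\bot$; $\mathrm{case}\ s\ (x.b_l)\ (x.b_r):T$ if $s:A+B$, $\Gamma.(x:A)\vdash b_l:T$, $\Gamma.(x:B)\vdash b_r:T$). $r[l..]$ substitutes $l$ for the last context variable of $r$. Conversion $\Gamma\vdash t\equiv u:A$ is the least typed congruent equivalence relation containing the $\beta$- and $\eta$-laws of every type former (the equational theory of bicartesian closed categories). Normal forms $\Gamma\vdash t\Leftarrow A$ (checking) and neutral forms $\Gamma\vdash t\Rightarrow A$ (inferring) are defined mutually inductively: checking: $\star\Leftarrow\top$; $(t,u)\Leftarrow A\times B$ if $t\Leftarrow A$, $u\Leftarrow B$; $\lambda x.t\Leftarrow A\to B$ if $\Gamma.(x:A)\vdash t\Leftarrow B$; $\mathrm{inl}\,a\Leftarrow A+B$ if $a\Leftarrow A$; $\mathrm{inr}\,b\Leftarrow A+B$ if $b\Leftarrow B$; $t\Leftarrow A$ if $t\Rightarrow A$; $\mathrm{raise}\,t\Leftarrow A$ (any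 $A$) if $t\Rightarrow\bot$; $\mathrm{case}\ s\ (x.b_l)\ (x.b_r)\Leftarrow T$ if $s\Rightarrow A+B$, $\Gamma.(x:A)\vdash b_l\Leftarrow T$, $\Gamma.(x:B)\vdash b_r\Leftarrow T$. Inferring: $x\Rightarrow A$ if $(x:A)\in\Gamma$; $\pi_1 p\Rightarrow A$ and $\pi_2 p\Rightarrow B$ if $p\Rightarrow A\times B$; $t\,u\Rightarrow B$ if $t\Rightarrow A\to B$ and $u\Leftarrow A$. Polarised vocabulary: $b^+=\{b\}$, $b^-=\emptyset$; $\top^p=\bot^p=\emptyset$; $(A+B)^p=(A\times B)^p=A^p\cup B^p$; $(A\to B)^p=A^{\bar p}\cup B^p$, with $\bar+=-$, $\bar-=+$; for contexts $(\Gamma.(x:A))^p=\Gamma^p\cup A^p$, empty context empty. Context partition $\Gamma=\Gamma_1\,|\,\Gamma_2$: the empty context partitions as empty|empty, and if $\Gamma=\Gamma_1|\Gamma_2$ then $\Gamma.(x:A)=\Gamma_1.(x:A)\,|\,\Gamma_2$ and $\Gamma.(x:A)=\Gamma_1\,|\,\Gamma_2.(x:A)$; i.e. each variable of $\Gamma$ is assigned to exactly one of $\Gamma_1,\Gamma_2$, preserving order. Terms over $\Gamma_s$ or $\Gamma_t$ are viewed in $\Gamma$ via the induced renamings. *)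

(* Defs.v *)
From Stdlib Require Import List Ensembles.
Import ListNotations.

Inductive ty (B : Type) : Type :=
| Base (b : B)
| Top
| Prod (A1 A2 : ty B)
| Arr (A1 A2 : ty B)
| Bot
| Sum (A1 A2 : ty B).
Arguments Base {B} b.
Arguments Top {B}.
Arguments Prod {B} A1 A2.
Arguments Arr {B} A1 A2.
Arguments Bot {B}.
Arguments Sum {B} A1 A2.

(* The head of the list is the last variable of the context: the paper's
   extension of G by (x : A) is [A :: G], and the new variable is [Var 0]. *)
Definition ctx (B : Type) : Type := list (ty B).

(* Untyped de Bruijn terms; [Lam] binds one variable in its body and [Case]
   binds one variable in each branch. *)
Inductive tm : Type :=
| Var (n : nat)
| Star
| Pair (t u : tm)
| Fst (t : tm)
| Snd (t : tm)
| Lam (t : tm)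
| App (t u : tm)
| Raise (t : tm)
| Inl (t : tm)
| Inr (t : tm)
| Case (s bl br : tm).

Definition up_ren (rho : nat -> nat) (n : nat) : nat :=
  match n with
  | 0 => 0
  | S m => S (rho m)
  end.

Fixpoint ren (rho : nat -> nat) (t : tm) : tm :=
  match t with
  | Var n => Var (rho n)
  | Star => Star
  | Pair t u => Pair (ren rho t) (ren rho u)
  | Fst t => Fst (ren rho t)
  | Snd t => Snd (ren rho t)
  | Lam t => Lam (ren (up_ren rho) t)
  | App t u => App (ren rho t) (ren rho u)
  | Raise t => Raise (ren rho t)
  | Inl t => Inl (ren rho t)
  | Inr t => Inr (ren rho t)
  | Case s bl br => Case (ren rho s) (ren (up_ren rho) bl) (ren (up_ren rho) br)
  end.

Definition scons (u : tm) (sigma : nat -> tm) (n : nat) : tm :=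
  match n with
  | 0 => u
  | S m => sigma m
  end.

Definition up_sub (sigma : nat -> tm) : nat -> tm :=
  scons (Var 0) (fun n => ren S (sigma n)).

Fixpoint sub (sigma : nat -> tm) (t : tm) : tm :=
  match t with
  | Var n => sigma n
  | Star => Star
  | Pair t u => Pair (sub sigma t) (sub sigma u)
  | Fst t => Fst (sub sigma t)
  | Snd t => Snd (sub sigma t)
  | Lam t => Lam (sub (up_sub sigma) t)
  | App t u => App (sub sigma t) (sub sigma u)
  | Raise t => Raise (sub sigma t)
  | Inl t => Inl (sub sigma t)
  | Inr t => Inr (sub sigma t)
  | Case s bl br => Case (sub sigma s) (sub (up_sub sigma) bl) (sub (up_sub sigma) br)
  end.

(* [sub1 r l] is the paper's r[l..]. *)
Definition sub1 (r l : tm) : tm := sub (scons l Var) r.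

Inductive typed {B : Type} : ctx B -> tm -> ty B -> Prop :=
| ty_Var G n A :
    nth_error G n = Some A -> typed G (Var n) A
| ty_Star G :
    typed G Star Top
| ty_Pair G t u A1 A2 :
    typed G t A1 -> typed G u A2 -> typed G (Pair t u) (Prod A1 A2)
| ty_Fst G t A1 A2 :
    typed G t (Prod A1 A2) -> typed G (Fst t) A1
| ty_Snd G t A1 A2 :
    typed G t (Prod A1 A2) -> typed G (Snd t) A2
| ty_Lam G t A1 A2 :
    typed (A1 :: G) t A2 -> typed G (Lam t) (Arr A1 A2)
| ty_App G t u A1 A2 :
    typed G t (Arr A1 A2) -> typed G u A1 -> typed G (App t u) A2
| ty_Raise G t A :
    typed G t Bot -> typed G (Raise t) A
| ty_Inl G t A1 A2 :
    typed G t A1 -> typed G (Inl t) (Sum A1 A2)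
| ty_Inr G t A1 A2 :
    typed G t A2 -> typed G (Inr t) (Sum A1 A2)
| ty_Case G s bl br A1 A2 T :
    typed G s (Sum A1 A2) -> typed (A1 :: G) bl T -> typed (A2 :: G) br T ->
    typed G (Case s bl br) T.

(* The eta-laws of [Bot] and [Sum] are the strong ones, for an arbitrary term
   [t] with a distinguished variable of the eliminated type; these are the
   uniqueness parts of the universal properties of the initial object and of
   the coproduct in a bicartesian closed category. *)
Inductive conv {B : Type} : ctx B -> tm -> tm -> ty B -> Prop :=
| conv_refl G t A :
    typed G t A -> conv G t t A
| conv_sym G t u A :
    conv G t u A -> conv G u t A
| conv_trans G t u v A :
    conv G t u A -> conv G u v A -> conv G t v A
| conv_Pair G t t' u u' A1 A2 :
    conv G t t' A1 -> conv G u u' A2 ->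
    conv G (Pair t u) (Pair t' u') (Prod A1 A2)
| conv_Fst G t t' A1 A2 :
    conv G t t' (Prod A1 A2) -> conv G (Fst t) (Fst t') A1
| conv_Snd G t t' A1 A2 :
    conv G t t' (Prod A1 A2) -> conv G (Snd t) (Snd t') A2
| conv_Lam G t t' A1 A2 :
    conv (A1 :: G) t t' A2 -> conv G (Lam t) (Lam t') (Arr A1 A2)
| conv_App G t t' u u' A1 A2 :
    conv G t t' (Arr A1 A2) -> conv G u u' A1 ->
    conv G (App t u) (App t' u') A2
| conv_Raise G t t' A :
    conv G t t' Bot -> conv G (Raise t) (Raise t') A
| conv_Inl G t t' A1 A2 :
    conv G t t' A1 -> conv G (Inl t) (Inl t') (Sum A1 A2)
| conv_Inr G t t' A1 A2 :
    conv G t t' A2 -> conv G (Inr t) (Inr t') (Sum A1 A2)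
| conv_Case G s s' bl bl' br br' A1 A2 T :
    conv G s s' (Sum A1 A2) ->
    conv (A1 :: G) bl bl' T -> conv (A2 :: G) br br' T ->
    conv G (Case s bl br) (Case s' bl' br') T
| conv_beta_Fst G t u A1 A2 :
    typed G t A1 -> typed G u A2 -> conv G (Fst (Pair t u)) t A1
| conv_beta_Snd G t u A1 A2 :
    typed G t A1 -> typed G u A2 -> conv G (Snd (Pair t u)) u A2
| conv_beta_App G t u A1 A2 :
    typed (A1 :: G) t A2 -> typed G u A1 ->
    conv G (App (Lam t) u) (sub1 t u) A2
| conv_beta_Inl G a bl br A1 A2 T :
    typed G a A1 -> typed (A1 :: G) bl T -> typed (A2 :: G) br T ->
    conv G (Case (Inl a) bl br) (sub1 bl a) T
| conv_beta_Inr G a bl br A1 A2 T :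
    typed G a A2 -> typed (A1 :: G) bl T -> typed (A2 :: G) br T ->
    conv G (Case (Inr a) bl br) (sub1 br a) T
| conv_eta_Top G t :
    typed G t Top -> conv G t Star Top
| conv_eta_Prod G t A1 A2 :
    typed G t (Prod A1 A2) -> conv G t (Pair (Fst t) (Snd t)) (Prod A1 A2)
| conv_eta_Arr G t A1 A2 :
    typed G t (Arr A1 A2) ->
    conv G t (Lam (App (ren S t) (Var 0))) (Arr A1 A2)
| conv_eta_Bot G s t T :
    typed G s Bot -> typed (Bot :: G) t T ->
    conv G (sub1 t s) (Raise s) T
| conv_eta_Sum G s t A1 A2 T :
    typed G s (Sum A1 A2) -> typed (Sum A1 A2 :: G) t T ->
    conv G (sub1 t s)
      (Case s (sub (scons (Inl (Var 0)) (fun n => Var (S n))) t)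
              (sub (scons (Inr (Var 0)) (fun n => Var (S n))) t)) T.

Inductive nf {B : Type} : ctx B -> tm -> ty B -> Prop :=
| nf_Star G :
    nf G Star Top
| nf_Pair G t u A1 A2 :
    nf G t A1 -> nf G u A2 -> nf G (Pair t u) (Prod A1 A2)
| nf_Lam G t A1 A2 :
    nf (A1 :: G) t A2 -> nf G (Lam t) (Arr A1 A2)
| nf_Inl G a A1 A2 :
    nf G a A1 -> nf G (Inl a) (Sum A1 A2)
| nf_Inr G b A1 A2 :
    nf G b A2 -> nf G (Inr b) (Sum A1 A2)
| nf_ne G t A :
    ne G t A -> nf G t A
| nf_Raise G t A :
    ne G t Bot -> nf G (Raise t) A
| nf_Case G s bl br A1 A2 T :
    ne G s (Sum A1 A2) -> nf (A1 :: G) bl T -> nf (A2 :: G) br T ->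
    nf G (Case s bl br) T
with ne {B : Type} : ctx B -> tm -> ty B -> Prop :=
| ne_Var G n A :
    nth_error G n = Some A -> ne G (Var n) A
| ne_Fst G t A1 A2 :
    ne G t (Prod A1 A2) -> ne G (Fst t) A1
| ne_Snd G t A1 A2 :
    ne G t (Prod A1 A2) -> ne G (Snd t) A2
| ne_App G t u A1 A2 :
    ne G t (Arr A1 A2) -> nf G u A1 -> ne G (App t u) A2.

Inductive pol : Set := Pos | Neg.

Definition opp (p : pol) : pol :=
  match p with
  | Pos => Neg
  | Neg => Pos
  end.

Declare Scope voc_scope.
Delimit Scope voc_scope with voc.
Notation "X '∪' Y" := (Union _ X Y) (at level 50, left associativity) : voc_scope.
Notation "X '∩' Y" := (Intersection _ X Y) (at level 40, left associativity) : voc_scope.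
Notation "X '⊆' Y" := (Included _ X Y) (at level 70, no associativity) : voc_scope.
Open Scope voc_scope.

Fixpoint voc {B : Type} (p : pol) (A : ty B) : Ensemble B :=
  match A with
  | Base b =>
      match p with
      | Pos => Singleton B b
      | Neg => Empty_set B
      end
  | Top => Empty_set B
  | Bot => Empty_set B
  | Prod A1 A2 => voc p A1 ∪ voc p A2
  | Sum A1 A2 => voc p A1 ∪ voc p A2
  | Arr A1 A2 => voc (opp p) A1 ∪ voc p A2
  end.

Fixpoint ctx_voc {B : Type} (p : pol) (G : ctx B) : Ensemble B :=
  match G with
  | [] => Empty_set B
  | A :: G' => ctx_voc p G' ∪ voc p A
  end.

(* A partition lives in [Type], not [Prop]: one triple of contexts may admit
   several partitions, and the renamings below depend on which one is given. *)
Inductive ctx_partition {B : Type} : ctx B -> ctx B -> ctx B -> Type :=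
| part_nil : ctx_partition [] [] []
| part_l G G1 G2 A :
    ctx_partition G G1 G2 -> ctx_partition (A :: G) (A :: G1) G2
| part_r G G1 G2 A :
    ctx_partition G G1 G2 -> ctx_partition (A :: G) G1 (A :: G2).

Fixpoint ren_l {B : Type} {G G1 G2 : ctx B} (P : ctx_partition G G1 G2) : nat -> nat :=
  match P with
  | part_nil => fun n => n
  | part_l _ _ _ _ P' => up_ren (ren_l P')
  | part_r _ _ _ _ P' => fun n => S (ren_l P' n)
  end.

Fixpoint ren_r {B : Type} {G G1 G2 : ctx B} (P : ctx_partition G G1 G2) : nat -> nat :=
  match P with
  | part_nil => fun n => n
  | part_l _ _ _ _ P' => fun n => S (ren_r P' n)
  | part_r _ _ _ _ P' => up_ren (ren_r P')
  end.

(* Main.v *)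
Require Import Defs.
From Stdlib Require Import List Ensembles.
Import ListNotations.

(** The proof is a simultaneous induction on normal and neutral forms, over all
    partitions of the context.  A neutral form inherits the vocabulary of the
    side of the partition its head variable lives on, and this decides which
    side the interpolant comes from; the argument of a neutral application is
    interpolated in the partition oriented by the head, i.e. the swapped one
    when the head is a source variable.  Interpolants of subterms are combined
    by products.  When a neutral [t] with head in the source factors through
    [M] in the reverse direction, the normal form [t : T] factors through
    [M -> T], and a case analysis on such a [t] factors through
    [M -> M1 + M2], by the commuting conversion for nested case analyses. *)

(** * Substitution calculus *)

Lemma up_sub_ext (s s' : nat -> tm) (n : nat) :
  (forall n, s n = s' n) -> up_sub s n = up_sub s' n.
Proof. intros H; destruct n; simpl; [|rewrite H]; reflexivity. Qed.

Lemma sub_ext (s s' : nat -> tm) (t : tm) :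
  (forall n, s n = s' n) -> sub s t = sub s' t.
Proof.
  revert s s'; induction t; intros f g H; simpl; f_equal; auto;
    match goal with IH : forall f g, _ -> _ = _ |- _ => apply IH end;
    intros m; apply up_sub_ext; assumption.
Qed.

Lemma ren_as_sub (f : nat -> nat) (t : tm) :
  ren f t = sub (fun n => Var (f n)) t.
Proof.
  revert f; induction t; intros f; simpl; f_equal; auto;
    match goal with IH : forall f, _ = _ |- _ => rewrite IH end;
    apply sub_ext; intros [|m]; reflexivity.
Qed.

Lemma sub_Var (t : tm) : sub Var t = t.
Proof.
  (* The claim is generalised because [up_sub Var] agrees with [Var] only pointwise, which is all
     that survives under a binder. *)
  assert (H : forall s, (forall n, s n = Var n) -> sub s t = t).
  { induction t; intros f H; simpl; f_equal; auto;
      match goal with IH : forall s, _ -> _ = ?t |- _ = ?t => apply IH end;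
      intros [|m]; simpl; rewrite ?H; reflexivity. }
  auto.
Qed.

Lemma sub_ren (s : nat -> tm) (f : nat -> nat) (t : tm) :
  sub s (ren f t) = sub (fun n => s (f n)) t.
Proof.
  revert s f; induction t; intros s f; simpl; f_equal; auto;
    match goal with IH : forall s f, _ = _ |- _ => rewrite IH end;
    apply sub_ext; intros [|m]; reflexivity.
Qed.

Lemma ren_ren (f g : nat -> nat) (t : tm) :
  ren f (ren g t) = ren (fun n => f (g n)) t.
Proof. rewrite ren_as_sub, sub_ren, (ren_as_sub (fun n => f (g n))); reflexivity. Qed.

Lemma ren_sub (f : nat -> nat) (s : nat -> tm) (t : tm) :
  ren f (sub s t) = sub (fun n => ren f (s n)) t.
Proof.
  revert f s; induction t; intros f s; simpl; f_equal; auto;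
    match goal with IH : forall s f, _ = _ |- _ => rewrite IH end;
    apply sub_ext; intros [|m]; simpl; rewrite ?ren_ren; reflexivity.
Qed.

Lemma sub_sub (s s' : nat -> tm) (t : tm) :
  sub s (sub s' t) = sub (fun n => sub s (s' n)) t.
Proof.
  revert s s'; induction t; intros s s'; simpl; f_equal; auto;
    match goal with IH : forall s s', _ = _ |- _ => rewrite IH end;
    apply sub_ext; intros [|m]; simpl; rewrite ?sub_ren, ?ren_sub; reflexivity.
Qed.

Ltac sub_norm :=
  unfold sub1; repeat (rewrite sub_sub || rewrite sub_ren || rewrite ren_sub || rewrite ren_ren).

(** Fuses each side into a single substitution and compares pointwise; the split at indices 0, 1, 2
    covers the binders and the interpolant variable. *)
Ltac sub_eq :=
  simpl; sub_norm; rewrite ?ren_as_sub;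
  first
    [ reflexivity
    | match goal with
      | |- sub _ ?t = sub _ ?t => apply sub_ext; intros [|[|[|?]]]; sub_eq
      | |- sub _ ?t = ?t => transitivity (sub Var t); [sub_eq | apply sub_Var]
      | |- ?t = sub _ ?t => symmetry; sub_eq
      end ].

(** Below a binder the interpolant variable comes innermost, in [M :: A :: G2], whereas rebuilding
    the binder requires [A :: M :: G2]. *)
Definition swap01 (n : nat) : nat :=
  match n with
  | 0 => 1
  | 1 => 0
  | S (S m) => S (S m)
  end.

(** * Typing *)

Definition ren_typed {B : Type} (f : nat -> nat) (G G' : ctx B) : Prop :=
  forall n A, nth_error G n = Some A -> nth_error G' (f n) = Some A.

Definition sub_typed {B : Type} (s : nat -> tm) (G G' : ctx B) : Prop :=
  forall n A, nth_error G n = Some A -> typed G' (s n) A.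

Lemma ren_typed_S {B : Type} (G : ctx B) (A : ty B) : ren_typed S G (A :: G).
Proof. intros n C H; exact H. Qed.

Lemma ren_typed_up {B : Type} (f : nat -> nat) (G G' : ctx B) (A : ty B) :
  ren_typed f G G' -> ren_typed (up_ren f) (A :: G) (A :: G').
Proof. intros H [|n] C HC; simpl in *; auto. Qed.

Lemma ren_typed_shift {B : Type} (f : nat -> nat) (G G' : ctx B) (A : ty B) :
  ren_typed f G G' -> ren_typed (fun n => S (f n)) G (A :: G').
Proof. intros H n C HC; simpl; auto. Qed.

Lemma ren_typed_swap01 {B : Type} (G : ctx B) (A C : ty B) :
  ren_typed swap01 (A :: C :: G) (C :: A :: G).
Proof. intros [|[|n]] D H; exact H. Qed.

Lemma typed_ren {B : Type} (G : ctx B) (t : tm) (A : ty B) :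
  typed G t A ->
  forall f G', ren_typed f G G' -> typed G' (ren f t) A.
Proof.
  induction 1; intros f G' Hf; simpl; econstructor; eauto using ren_typed_up.
Qed.

Lemma sub_typed_up {B : Type} (s : nat -> tm) (G G' : ctx B) (A : ty B) :
  sub_typed s G G' -> sub_typed (up_sub s) (A :: G) (A :: G').
Proof.
  intros H [|n] C HC; simpl in *.
  - constructor; exact HC.
  - eapply typed_ren; [eauto | apply ren_typed_S].
Qed.

Lemma typed_sub {B : Type} (G : ctx B) (t : tm) (A : ty B) :
  typed G t A ->
  forall s G', sub_typed s G G' -> typed G' (sub s t) A.
Proof.
  induction 1; intros s' G' Hs; simpl; [apply Hs; assumption | ..];
    econstructor; eauto using sub_typed_up.
Qed.

Lemma sub_typed_scons {B : Type} (G G' : ctx B) (f : nat -> nat) (u : tm) (A : ty B) :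
  typed G' u A -> ren_typed f G G' ->
  sub_typed (scons u (fun n => Var (f n))) (A :: G) G'.
Proof.
  intros Hu Hf [|n] C HC; simpl in *.
  - injection HC as <-; exact Hu.
  - constructor; auto.
Qed.

Lemma typed_sub1 {B : Type} (G : ctx B) (t u : tm) (A T : ty B) :
  typed (A :: G) t T -> typed G u A -> typed G (sub1 t u) T.
Proof.
  intros Ht Hu; eapply typed_sub; [exact Ht|].
  apply (sub_typed_scons G G (fun n => n)); [exact Hu | intros n C H; exact H].
Qed.

Scheme nf_ne_ind := Induction for nf Sort Prop
with ne_nf_ind := Induction for ne Sort Prop.
Combined Scheme nf_ne_mutind from nf_ne_ind, ne_nf_ind.

Lemma nf_ne_typed (B : Type) :
  (forall (G : ctx B) t A, nf G t A -> typed G t A) /\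
  (forall (G : ctx B) t A, ne G t A -> typed G t A).
Proof.
  apply (nf_ne_mutind B (fun G t A _ => typed G t A) (fun G t A _ => typed G t A));
    intros; eauto using typed.
Qed.

(** * Conversion *)

(* Going through a beta-redex avoids proving that conversion is stable under
   substitution. *)
Lemma conv_sub1 {B : Type} (G : ctx B) (r a b : tm) (M T : ty B) :
  typed (M :: G) r T -> typed G a M -> typed G b M -> conv G a b M ->
  conv G (sub1 r a) (sub1 r b) T.
Proof.
  intros Hr Ha Hb Hab.
  eapply conv_trans; [apply conv_sym; eapply conv_beta_App; eassumption|].
  eapply conv_trans; [|eapply conv_beta_App; eassumption].
  eapply conv_App; [apply conv_refl, ty_Lam; eassumption | exact Hab].
Qed.

(** Renaming [r] under its first variable turns both sides into instances of [sub1], so [conv_sub1]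
    applies. *)
Lemma conv_sub_scons {B : Type} (G G' : ctx B) (f : nat -> nat) (r a b : tm) (M T : ty B) :
  ren_typed f G G' ->
  typed (M :: G) r T -> typed G' a M -> typed G' b M -> conv G' a b M ->
  conv G' (sub (scons a (fun n => Var (f n))) r)
          (sub (scons b (fun n => Var (f n))) r) T.
Proof.
  intros Hf Hr Ha Hb Hab.
  replace (sub (scons a (fun n => Var (f n))) r) with (sub1 (ren (up_ren f) r) a) by sub_eq.
  replace (sub (scons b (fun n => Var (f n))) r) with (sub1 (ren (up_ren f) r) b) by sub_eq.
  eapply conv_sub1; eauto using typed_ren, ren_typed_up.
Qed.

Lemma conv_eq_l {B : Type} (G : ctx B) (t t' u : tm) (A : ty B) :
  t = t' -> conv G t' u A -> conv G t u A.
Proof. intros ->; auto. Qed.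

Lemma conv_Case_Case_Inl {B : Type} (G : ctx B) (x a b c d : tm) (A1 A2 M1 M2 T : ty B) :
  typed G x A1 -> typed (A1 :: G) a M1 -> typed (A2 :: G) b M2 ->
  typed (M1 :: G) c T -> typed (M2 :: G) d T ->
  conv G (Case (Case (Inl x) (Inl a) (Inr b)) c d) (sub1 c (sub1 a x)) T.
Proof.
  intros Hx Ha Hb Hc Hd.
  eapply conv_trans.
  - eapply conv_Case with (A1 := M1) (A2 := M2).
    + eapply conv_beta_Inl; [exact Hx | apply ty_Inl; exact Ha | apply ty_Inr; exact Hb].
    + apply conv_refl; exact Hc.
    + apply conv_refl; exact Hd.
  - eapply conv_beta_Inl with (A2 := M2); [|exact Hc|exact Hd].
    eapply typed_sub1; eassumption.
Qed.

Lemma conv_Case_Case_Inr {B : Type} (G : ctx B) (x a b c d : tm) (A1 A2 M1 M2 T : ty B) :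
  typed G x A2 -> typed (A1 :: G) a M1 -> typed (A2 :: G) b M2 ->
  typed (M1 :: G) c T -> typed (M2 :: G) d T ->
  conv G (Case (Case (Inr x) (Inl a) (Inr b)) c d) (sub1 d (sub1 b x)) T.
Proof.
  intros Hx Ha Hb Hc Hd.
  eapply conv_trans.
  - eapply conv_Case with (A1 := M1) (A2 := M2).
    + eapply conv_beta_Inr; [exact Hx | apply ty_Inl; exact Ha | apply ty_Inr; exact Hb].
    + apply conv_refl; exact Hc.
    + apply conv_refl; exact Hd.
  - eapply conv_beta_Inr with (A1 := M1); [|exact Hc|exact Hd].
    eapply typed_sub1; eassumption.
Qed.

(* The strong eta-law for [s], followed by two beta-steps in each branch. *)
Lemma conv_Case_Case {B : Type} (G : ctx B) (s a b c d : tm) (A1 A2 M1 M2 T : ty B) :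
  typed G s (Sum A1 A2) ->
  typed (A1 :: G) a M1 -> typed (A2 :: G) b M2 ->
  typed (M1 :: G) c T -> typed (M2 :: G) d T ->
  conv G (Case (Case s (Inl a) (Inr b)) c d)
         (Case s (sub (scons a (fun n => Var (S n))) c)
                 (sub (scons b (fun n => Var (S n))) d)) T.
Proof.
  intros Hs Ha Hb Hc Hd.
  (* The nested case with its scrutinee abstracted as variable 0 and all else weakened past it:
     [sub1 t s] is the left-hand side, ready for the eta-law. *)
  set (t := Case (Case (Var 0) (Inl (ren (up_ren S) a)) (Inr (ren (up_ren S) b)))
                 (ren (up_ren S) c) (ren (up_ren S) d)).
  assert (Hup : forall (C D : ty B) u E,
             typed (C :: G) u E -> typed (C :: D :: G) (ren (up_ren S) u) E).
  { intros C D u E Hu; eapply typed_ren; [eassumption | apply ren_typed_up, ren_typed_S]. }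
  assert (Ht : typed (Sum A1 A2 :: G) t T).
  { eapply ty_Case with (A1 := M1) (A2 := M2); auto.
    eapply ty_Case with (A1 := A1) (A2 := A2);
      [constructor; reflexivity | apply ty_Inl | apply ty_Inr]; auto. }
  (* The eta-law replaces variable 0 by an injection; weakened subterms do not contain that variable
     and are unchanged. *)
  assert (Hv : forall v u,
      sub (up_sub (scons v (fun n => Var (S n)))) (ren (up_ren S) u) = ren (up_ren S) u)
    by (intros v u; sub_eq).
  apply conv_eq_l with (t' := sub1 t s).
  { unfold t, sub1; simpl; f_equal; [f_equal; f_equal|..]; sub_eq. }
  eapply conv_trans; [eapply conv_eta_Sum; eassumption|].
  eapply conv_Case; [apply conv_refl; exact Hs | unfold t; simpl; rewrite !Hv ..].
  - replace (sub (scons a (fun n => Var (S n))) c)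
      with (sub1 (ren (up_ren S) c) (sub1 (ren (up_ren S) a) (Var 0))).
    + eapply conv_Case_Case_Inl; eauto; constructor; reflexivity.
    + replace (sub1 (ren (up_ren S) a) (Var 0)) with a by (symmetry; sub_eq); sub_eq.
  - replace (sub (scons b (fun n => Var (S n))) d)
      with (sub1 (ren (up_ren S) d) (sub1 (ren (up_ren S) b) (Var 0))).
    + eapply conv_Case_Case_Inr; eauto; constructor; reflexivity.
    + replace (sub1 (ren (up_ren S) b) (Var 0)) with b by (symmetry; sub_eq); sub_eq.
Qed.

(** * Factorisations *)

(* [l] lives over the side [G1] and [r] over the side [G2]; up to
   [sub1_ren_up], the substituted term is the paper's r[l..] seen in [G]. *)
Definition factors {B : Type} (G G1 G2 : ctx B) (f1 f2 : nat -> nat)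
    (M : ty B) (l r t : tm) (T : ty B) : Prop :=
  typed G1 l M /\ typed (M :: G2) r T /\
  conv G (sub (scons (ren f1 l) (fun n => Var (f2 n))) r) t T.

Lemma sub1_ren_up (f : nat -> nat) (r u : tm) :
  sub1 (ren (up_ren f) r) u = sub (scons u (fun n => Var (f n))) r.
Proof. sub_eq. Qed.

Section Factors.

Context {B : Type} {G G1 G2 : ctx B} {f1 f2 : nat -> nat}.
Hypothesis Hf1 : ren_typed f1 G1 G.
Hypothesis Hf2 : ren_typed f2 G2 G.

Notation fac := (factors G G1 G2 f1 f2).

(** Since [e] recovers the old [l] from [l'], precomposing [r] with [e] is harmless up to
    conversion. This serves to enlarge an interpolant to a product, with [e] a projection. *)
Lemma factors_reindex (M M' : ty B) (l l' e r t : tm) (T : ty B) :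
  fac M l r t T -> typed G1 l' M' ->
  typed (M' :: G2) e M ->
  conv G (sub (scons (ren f1 l') (fun n => Var (f2 n))) e) (ren f1 l) M ->
  fac M' l' (sub (scons e (fun n => Var (S n))) r) t T.
Proof.
  intros (Hl & Hr & Hc) Hl' He Hconv; split; [exact Hl'|split].
  - eapply typed_sub; [exact Hr | apply sub_typed_scons; [exact He | apply ren_typed_S]].
  - eapply conv_trans; [|exact Hc].
    eapply conv_eq_l;
      [|eapply conv_sub_scons; [exact Hf2 | exact Hr | | | exact Hconv]].
    + sub_eq.
    + eapply typed_sub; [exact He | apply sub_typed_scons; [|exact Hf2]].
      eapply typed_ren; eassumption.
    + eapply typed_ren; eassumption.
Qed.

Lemma factors_fst (M M' : ty B) (l l' r t : tm) (T : ty B) :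
  fac M l r t T -> typed G1 l' M' ->
  fac (Prod M M') (Pair l l') (sub (scons (Fst (Var 0)) (fun n => Var (S n))) r) t T.
Proof.
  intros H Hl'; pose proof (proj1 H) as Hl.
  eapply factors_reindex; [exact H | constructor; assumption | |].
  - eapply ty_Fst; constructor; reflexivity.
  - simpl; eapply conv_beta_Fst; eapply typed_ren; eassumption.
Qed.

Lemma factors_snd (M M' : ty B) (l l' r t : tm) (T : ty B) :
  fac M' l' r t T -> typed G1 l M ->
  fac (Prod M M') (Pair l l') (sub (scons (Snd (Var 0)) (fun n => Var (S n))) r) t T.
Proof.
  intros H Hl; pose proof (proj1 H) as Hl'.
  eapply factors_reindex; [exact H | constructor; assumption | |].
  - eapply ty_Snd; constructor; reflexivity.
  - simpl; eapply conv_beta_Snd; eapply typed_ren; eassumption.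
Qed.

(** Pairing the two left halves gives a common [M] and [l], as the congruence lemmas with several
    subterms demand. *)
Lemma factors_join (C1 C2 : ty B) (t1 t2 : tm) (M1 M2 : ty B) (l1 l2 r1 r2 : tm) :
  fac M1 l1 r1 t1 C1 -> fac M2 l2 r2 t2 C2 ->
  exists l r1' r2', fac (Prod M1 M2) l r1' t1 C1 /\ fac (Prod M1 M2) l r2' t2 C2.
Proof.
  intros H1 H2; do 3 eexists; split.
  - eapply factors_fst; [exact H1 | exact (proj1 H2)].
  - eapply factors_snd; [exact H2 | exact (proj1 H1)].
Qed.

Lemma factors_Pair (M : ty B) (l r1 r2 t1 t2 : tm) (T1 T2 : ty B) :
  fac M l r1 t1 T1 -> fac M l r2 t2 T2 ->
  fac M l (Pair r1 r2) (Pair t1 t2) (Prod T1 T2).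
Proof.
  intros (Hl & Hr1 & Hc1) (_ & Hr2 & Hc2); repeat split; simpl; eauto using typed, conv.
Qed.

Lemma factors_App (M : ty B) (l r1 r2 t1 t2 : tm) (T1 T2 : ty B) :
  fac M l r1 t1 (Arr T1 T2) -> fac M l r2 t2 T1 ->
  fac M l (App r1 r2) (App t1 t2) T2.
Proof.
  intros (Hl & Hr1 & Hc1) (_ & Hr2 & Hc2); repeat split; simpl; eauto using typed, conv.
Qed.

Lemma factors_Fst (M : ty B) (l r t : tm) (T1 T2 : ty B) :
  fac M l r t (Prod T1 T2) -> fac M l (Fst r) (Fst t) T1.
Proof. intros (Hl & Hr & Hc); repeat split; simpl; eauto using typed, conv. Qed.

Lemma factors_Snd (M : ty B) (l r t : tm) (T1 T2 : ty B) :
  fac M l r t (Prod T1 T2) -> fac M l (Snd r) (Snd t) T2.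
Proof. intros (Hl & Hr & Hc); repeat split; simpl; eauto using typed, conv. Qed.

Lemma factors_Inl (M : ty B) (l r t : tm) (T1 T2 : ty B) :
  fac M l r t T1 -> fac M l (Inl r) (Inl t) (Sum T1 T2).
Proof. intros (Hl & Hr & Hc); repeat split; simpl; eauto using typed, conv. Qed.

Lemma factors_Inr (M : ty B) (l r t : tm) (T1 T2 : ty B) :
  fac M l r t T2 -> fac M l (Inr r) (Inr t) (Sum T1 T2).
Proof. intros (Hl & Hr & Hc); repeat split; simpl; eauto using typed, conv. Qed.

Lemma factors_Raise (M : ty B) (l r t : tm) (T : ty B) :
  fac M l r t Bot -> fac M l (Raise r) (Raise t) T.
Proof. intros (Hl & Hr & Hc); repeat split; simpl; eauto using typed, conv. Qed.

Lemma factors_Star : fac Top Star Star Star Top.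
Proof. repeat split; simpl; eauto using typed, conv. Qed.

(** A variable of the right side needs nothing from the left, hence the interpolant [Top]; the index
    [S n] skips the interpolant variable. *)
Lemma factors_Var (n : nat) (T : ty B) :
  nth_error G2 n = Some T -> fac Top Star (Var (S n)) (Var (f2 n)) T.
Proof.
  intros H; repeat split; simpl; [constructor | constructor; exact H |].
  apply conv_refl; constructor; auto.
Qed.

(** The bound variable belongs to the right side, so [f2] is lifted while [f1] is only shifted, and
    [l] never mentions it. *)
Lemma factors_under_binder (A : ty B) (M : ty B) (l r t : tm) (T : ty B) :
  factors (A :: G) G1 (A :: G2) (fun n => S (f1 n)) (up_ren f2) M l r t T ->
  typed (A :: M :: G2) (ren swap01 r) T /\
  conv (A :: G) (sub (up_sub (scons (ren f1 l) (fun n => Var (f2 n)))) (ren swap01 r)) t T.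
Proof.
  intros (Hl & Hr & Hc); split.
  - eapply typed_ren; [exact Hr | apply ren_typed_swap01].
  - eapply conv_eq_l; [|exact Hc]; sub_eq.
Qed.

Lemma factors_Lam (A : ty B) (M : ty B) (l r t : tm) (T : ty B) :
  factors (A :: G) G1 (A :: G2) (fun n => S (f1 n)) (up_ren f2) M l r t T ->
  fac M l (Lam (ren swap01 r)) (Lam t) (Arr A T).
Proof.
  intros H; destruct (factors_under_binder _ _ _ _ _ _ H) as [Hr Hc].
  split; [exact (proj1 H)|split; [constructor; exact Hr | constructor; exact Hc]].
Qed.

Lemma factors_Case (A1 A2 : ty B) (M : ty B) (l rs rl rr s bl br : tm) (T : ty B) :
  fac M l rs s (Sum A1 A2) ->
  factors (A1 :: G) G1 (A1 :: G2) (fun n => S (f1 n)) (up_ren f2) M l rl bl T ->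
  factors (A2 :: G) G1 (A2 :: G2) (fun n => S (f1 n)) (up_ren f2) M l rr br T ->
  fac M l (Case rs (ren swap01 rl) (ren swap01 rr)) (Case s bl br) T.
Proof.
  intros (Hl & Hr & Hc) H1 H2.
  destruct (factors_under_binder _ _ _ _ _ _ H1) as [Hr1 Hc1].
  destruct (factors_under_binder _ _ _ _ _ _ H2) as [Hr2 Hc2].
  split; [exact Hl | split; [econstructor; eassumption | simpl; econstructor; eassumption]].
Qed.

(** The left side offers its half as a function of the interpolant variable, the right side supplies
    the argument [l], and one beta-step restores the reverse factorisation. *)
Lemma factors_reverse (M : ty B) (l r t : tm) (T : ty B) :
  factors G G2 G1 f2 f1 M l r t T ->
  fac (Arr M T) (Lam r) (App (Var 0) (ren S l)) t T.
Proof.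
  intros (Hl & Hr & Hc); split; [constructor; exact Hr | split].
  - econstructor; [constructor; reflexivity | eapply typed_ren; [exact Hl | apply ren_typed_S]].
  - simpl; eapply conv_trans; [eapply conv_beta_App|].
    + eapply typed_ren; [exact Hr | apply ren_typed_up, Hf1].
    + replace (sub _ (ren S l)) with (ren f2 l) by (symmetry; sub_eq).
      eapply typed_ren; eassumption.
    + eapply conv_eq_l; [|exact Hc].
      replace (sub _ (ren S l)) with (ren f2 l) by (symmetry; sub_eq).
      apply sub1_ren_up.
Qed.

(** Given a value of [M], the left side can evaluate the scrutinee and return the tagged interpolant
    of the selected branch; the right side supplies [l] and finishes by a case analysis on the
    answer. *)
Lemma factors_Case_reverse (A1 A2 : ty B) (M M1 M2 : ty B)
    (l rs l1 r1 l2 r2 s bl br : tm) (T : ty B) :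
  typed G s (Sum A1 A2) ->
  factors G G2 G1 f2 f1 M l rs s (Sum A1 A2) ->
  factors (A1 :: G) (A1 :: G1) G2 (up_ren f1) (fun n => S (f2 n)) M1 l1 r1 bl T ->
  factors (A2 :: G) (A2 :: G1) G2 (up_ren f1) (fun n => S (f2 n)) M2 l2 r2 br T ->
  fac (Arr M (Sum M1 M2))
    (Lam (Case rs (Inl (ren (up_ren S) l1)) (Inr (ren (up_ren S) l2))))
    (Case (App (Var 0) (ren S l)) (ren (up_ren S) r1) (ren (up_ren S) r2))
    (Case s bl br) T.
Proof.
  intros Hs (Hl & Hr & Hc) (Hl1 & Hr1 & Hc1) (Hl2 & Hr2 & Hc2).
  assert (HS : forall (H : ctx B) (C D : ty B) u E,
             typed (C :: H) u E -> typed (C :: D :: H) (ren (up_ren S) u) E).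
  { intros H C D u E Hu; eapply typed_ren; [eassumption | apply ren_typed_up, ren_typed_S]. }
  assert (Hl1' : typed (A1 :: G) (ren (up_ren f1) l1) M1)
    by (eapply typed_ren; [exact Hl1 | apply ren_typed_up, Hf1]).
  assert (Hl2' : typed (A2 :: G) (ren (up_ren f1) l2) M2)
    by (eapply typed_ren; [exact Hl2 | apply ren_typed_up, Hf1]).
  assert (Hr1' : typed (M1 :: G) (ren (up_ren f2) r1) T)
    by (eapply typed_ren; [exact Hr1 | apply ren_typed_up, Hf2]).
  assert (Hr2' : typed (M2 :: G) (ren (up_ren f2) r2) T)
    by (eapply typed_ren; [exact Hr2 | apply ren_typed_up, Hf2]).
  (* First only the inner case, which returns [l1] or [l2] with a tag, is factored in the reverse
     direction; [factors_reverse] then turns it round. *)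
  assert (Hfac : factors G G2 G1 f2 f1 M l
             (Case rs (Inl (ren (up_ren S) l1)) (Inr (ren (up_ren S) l2)))
             (Case s (Inl (ren (up_ren f1) l1)) (Inr (ren (up_ren f1) l2))) (Sum M1 M2)).
  { split; [exact Hl | split].
    - econstructor; [exact Hr | apply ty_Inl | apply ty_Inr]; auto.
    - simpl; eapply conv_Case; [exact Hc | apply conv_Inl | apply conv_Inr];
        (eapply conv_eq_l; [|apply conv_refl; eassumption]); sub_eq. }
  apply factors_reverse in Hfac; destruct Hfac as (HL & HR & HC).
  split; [exact HL | split; [econstructor; [exact HR | auto ..]|]].
  simpl in HC |- *.
  eapply conv_trans; [eapply conv_Case; [exact HC | |]|].
  - eapply conv_eq_l; [|apply conv_refl; exact Hr1']; sub_eq.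
  - eapply conv_eq_l; [|apply conv_refl; exact Hr2']; sub_eq.
  (* The commuting conversion moves the outer case into the branches, where [Hc1] and [Hc2]
     apply. *)
  - eapply conv_trans; [eapply conv_Case_Case; eassumption|].
    eapply conv_Case; [apply conv_refl; exact Hs | |].
    + eapply conv_eq_l; [|exact Hc1]; sub_eq.
    + eapply conv_eq_l; [|exact Hc2]; sub_eq.
Qed.

End Factors.

(** * Partitions *)

Fixpoint part_swap {B : Type} {G G1 G2 : ctx B} (P : ctx_partition G G1 G2) :
    ctx_partition G G2 G1 :=
  match P with
  | part_nil => part_nil
  | part_l _ _ _ _ P' => part_r _ _ _ _ (part_swap P')
  | part_r _ _ _ _ P' => part_l _ _ _ _ (part_swap P')
  end.

(** An equality of functions, not just a pointwise one, so that it rewrites inside [factors]. *)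
Lemma ren_l_swap {B : Type} {G G1 G2 : ctx B} (P : ctx_partition G G1 G2) :
  ren_l (part_swap P) = ren_r P.
Proof. induction P; simpl; rewrite ?IHP; reflexivity. Qed.

Lemma ren_r_swap {B : Type} {G G1 G2 : ctx B} (P : ctx_partition G G1 G2) :
  ren_r (part_swap P) = ren_l P.
Proof. induction P; simpl; rewrite ?IHP; reflexivity. Qed.

Lemma ren_l_typed {B : Type} {G G1 G2 : ctx B} (P : ctx_partition G G1 G2) :
  ren_typed (ren_l P) G1 G.
Proof.
  induction P; simpl; auto using ren_typed_up, ren_typed_shift.
  intros n A H; exact H.
Qed.

Lemma ren_r_typed {B : Type} {G G1 G2 : ctx B} (P : ctx_partition G G1 G2) :
  ren_typed (ren_r P) G2 G.
Proof. rewrite <- ren_l_swap; apply ren_l_typed. Qed.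

Lemma part_lookup {B : Type} {G G1 G2 : ctx B} (P : ctx_partition G G1 G2) (n : nat) (A : ty B) :
  nth_error G n = Some A ->
  (exists m, nth_error G1 m = Some A /\ ren_l P m = n) \/
  (exists m, nth_error G2 m = Some A /\ ren_r P m = n).
Proof.
  revert n; induction P as [|G G1 G2 C P IH|G G1 G2 C P IH]; intros n H; simpl.
  - left; exists n; auto.
  - destruct n as [|n]; [left; exists 0; auto|].
    destruct (IH n H) as [(m & Hm & <-)|(m & Hm & <-)]; [left; exists (S m) | right; exists m]; auto.
  - destruct n as [|n]; [right; exists 0; auto|].
    destruct (IH n H) as [(m & Hm & <-)|(m & Hm & <-)]; [left; exists m | right; exists (S m)]; auto.
Qed.

(** * Vocabularies *)

Lemma In_Union {U : Type} (X Y : Ensemble U) (x : U) :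
  In U (X ∪ Y) x <-> In U X x \/ In U Y x.
Proof. split; [intros []; auto | intros []; auto using Union_introl, Union_intror]. Qed.

Lemma In_Intersection {U : Type} (X Y : Ensemble U) (x : U) :
  In U (X ∩ Y) x <-> In U X x /\ In U Y x.
Proof. split; [intros []; auto | intros []; split; auto]. Qed.

Lemma In_Empty_set {U : Type} (x : U) : In U (Empty_set U) x <-> False.
Proof. split; intros []. Qed.

Lemma ctx_voc_lookup {B : Type} (G : ctx B) (n : nat) (A : ty B) (p : pol) :
  nth_error G n = Some A -> voc p A ⊆ ctx_voc p G.
Proof.
  revert n; induction G as [|C G IH]; intros [|n] H x Hx; simpl in *; try discriminate.
  - injection H as <-; right; exact Hx.
  - left; exact (IH n H x Hx).
Qed.

(** Arrows flip polarity, so each inclusion is instantiated at both polarities; membership of a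
    fixed base type is then propositional. *)
Ltac voc_solve :=
  let p := fresh "p" in let x := fresh "x" in
  intros p x;
  repeat match goal with
  | H : forall p, voc p _ ⊆ _ |- _ =>
      pose proof (H Pos x); pose proof (H Neg x); clear H
  end;
  destruct p; simpl in *;
  rewrite ?In_Union, ?In_Intersection, ?In_Union, ?In_Empty_set in *; tauto.

(** * Interpolation *)

(** All partitions are quantified over because the induction extends them under binders and swaps
    them at arguments of source-headed applications. *)
Definition nf_interpolates {B : Type} (G : ctx B) (t : tm) (T : ty B) : Prop :=
  forall (Gs Gt : ctx B) (P : ctx_partition G Gs Gt),
  exists (M : ty B) (l r : tm),
    factors G Gs Gt (ren_l P) (ren_r P) M l r t T /\
    (forall p, voc p M ⊆ ctx_voc p Gs ∩ (ctx_voc (opp p) Gt ∪ voc p T)).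

(** The second alternative of (B), with the head in [Gt]; the first alternative is the same
    predicate at the swapped partition. *)
Definition ne_interpolates_from {B : Type} (G Gs Gt : ctx B) (P : ctx_partition G Gs Gt)
    (t : tm) (T : ty B) : Prop :=
  (forall p, voc p T ⊆ ctx_voc p Gt) /\
  exists (M : ty B) (l r : tm),
    factors G Gs Gt (ren_l P) (ren_r P) M l r t T /\
    (forall p, voc p M ⊆ ctx_voc p Gs ∩ ctx_voc (opp p) Gt).

Definition ne_interpolates {B : Type} (G : ctx B) (t : tm) (T : ty B) : Prop :=
  forall (Gs Gt : ctx B) (P : ctx_partition G Gs Gt),
  ne_interpolates_from G Gt Gs (part_swap P) t T \/ ne_interpolates_from G Gs Gt P t T.

(** The interpolant of [u] may use $A_1^p$, but $A_1^p \subseteq (A_1 \to A_2)^{\bar p} \subseteq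
    \Gamma_t^{\bar p}$, so the stricter bound for neutral forms still holds. *)
Lemma ne_interpolates_from_App {B : Type} (G Gs Gt : ctx B) (P : ctx_partition G Gs Gt)
    (t u : tm) (A1 A2 : ty B) :
  ne_interpolates_from G Gs Gt P t (Arr A1 A2) -> nf_interpolates G u A1 ->
  ne_interpolates_from G Gs Gt P (App t u) A2.
Proof.
  intros (HT & M & l & r & H & HM) Hu.
  destruct (Hu _ _ P) as (M' & l' & r' & H' & HM').
  destruct (factors_join (ren_l_typed P) (ren_r_typed P) _ _ _ _ _ _ _ _ _ _ H H')
    as (l0 & r1 & r2 & H1 & H2).
  split; [voc_solve|].
  do 3 eexists; split; [eapply factors_App; eassumption | voc_solve].
Qed.

Lemma ne_interpolates_from_Fst {B : Type} (G Gs Gt : ctx B) (P : ctx_partition G Gs Gt)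
    (t : tm) (A1 A2 : ty B) :
  ne_interpolates_from G Gs Gt P t (Prod A1 A2) ->
  ne_interpolates_from G Gs Gt P (Fst t) A1.
Proof.
  intros (HT & M & l & r & H & HM).
  split; [voc_solve|].
  do 3 eexists; split; [eapply factors_Fst; eassumption | voc_solve].
Qed.

Lemma ne_interpolates_from_Snd {B : Type} (G Gs Gt : ctx B) (P : ctx_partition G Gs Gt)
    (t : tm) (A1 A2 : ty B) :
  ne_interpolates_from G Gs Gt P t (Prod A1 A2) ->
  ne_interpolates_from G Gs Gt P (Snd t) A2.
Proof.
  intros (HT & M & l & r & H & HM).
  split; [voc_solve|].
  do 3 eexists; split; [eapply factors_Snd; eassumption | voc_solve].
Qed.

Lemma ne_interpolates_from_Var {B : Type} (G Gs Gt : ctx B) (P : ctx_partition G Gs Gt)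
    (n : nat) (A : ty B) :
  nth_error Gt n = Some A ->
  ne_interpolates_from G Gs Gt P (Var (ren_r P n)) A.
Proof.
  intros H; split; [intros p; eapply ctx_voc_lookup; exact H|].
  do 3 eexists; split; [apply factors_Var; [apply ren_r_typed | exact H] | voc_solve].
Qed.

(** With the head in the source, the arrow in [Arr M T] flips the polarity of the bound on [M] to
    the required one, and $T^p \subseteq \Gamma_s^p$ accounts for its codomain. *)
Lemma nf_interpolates_ne {B : Type} (G : ctx B) (t : tm) (T : ty B) :
  ne_interpolates G t T -> nf_interpolates G t T.
Proof.
  intros H Gs Gt P.
  destruct (H _ _ P) as [(HT & M & l & r & Hf & HM)|(HT & M & l & r & Hf & HM)].
  - rewrite ren_l_swap, ren_r_swap in Hf.
    do 3 eexists; split;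
      [apply factors_reverse; [apply ren_l_typed | apply ren_r_typed | exact Hf] | voc_solve].
  - do 3 eexists; split; [exact Hf | voc_solve].
Qed.

Lemma nf_interpolates_Case {B : Type} (G : ctx B) (s bl br : tm) (A1 A2 T : ty B) :
  typed G s (Sum A1 A2) -> ne_interpolates G s (Sum A1 A2) ->
  nf_interpolates (A1 :: G) bl T -> nf_interpolates (A2 :: G) br T ->
  nf_interpolates G (Case s bl br) T.
Proof.
  intros Hs H H1 H2 Gs Gt P.
  destruct (H _ _ P) as [(HT & M & l & r & Hf & HM)|(HT & M & l & r & Hf & HM)].
  - rewrite ren_l_swap, ren_r_swap in Hf.
    (* The type of the scrutinee has its vocabulary in [Gs], so placing the branch variables there
       adds no new base types. *)
    destruct (H1 _ _ (part_l _ _ _ A1 P)) as (M1 & l1 & r1 & Hf1 & HM1).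
    destruct (H2 _ _ (part_l _ _ _ A2 P)) as (M2 & l2 & r2 & Hf2 & HM2).
    do 3 eexists; split; [eapply factors_Case_reverse with (M1 := M1) (M2 := M2)|];
      eauto using ren_l_typed, ren_r_typed; voc_solve.
  (* Symmetrically, the vocabularies of [A1] and [A2] now lie in [Gt], and the branch variables go
     there. *)
  - destruct (H1 _ _ (part_r _ _ _ A1 P)) as (M1 & l1 & r1 & Hf1 & HM1).
    destruct (H2 _ _ (part_r _ _ _ A2 P)) as (M2 & l2 & r2 & Hf2 & HM2).
    pose proof (proj1 Hf) as Hl; pose proof (proj1 Hf1) as Hl1; pose proof (proj1 Hf2) as Hl2.
    simpl in Hf1, Hf2.
    (* One left half shared by the scrutinee and both branches; each of them projects out its own
       component. *)
    exists (Prod M (Prod M1 M2)), (Pair l (Pair l1 l2)).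
    eexists; split; [|voc_solve].
    apply factors_Case with (A1 := A1) (A2 := A2).
    + eapply factors_fst; [apply ren_l_typed | apply ren_r_typed | exact Hf | constructor; assumption].
    + eapply factors_snd; [apply (ren_l_typed (part_r _ _ _ A1 P))
        | apply (ren_r_typed (part_r _ _ _ A1 P)) | | exact Hl].
      eapply factors_fst; [apply (ren_l_typed (part_r _ _ _ A1 P))
        | apply (ren_r_typed (part_r _ _ _ A1 P)) | exact Hf1 | exact Hl2].
    + eapply factors_snd; [apply (ren_l_typed (part_r _ _ _ A2 P))
        | apply (ren_r_typed (part_r _ _ _ A2 P)) | | exact Hl].
      eapply factors_snd; [apply (ren_l_typed (part_r _ _ _ A2 P))
        | apply (ren_r_typed (part_r _ _ _ A2 P)) | exact Hf2 | exact Hl1].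
Qed.

Lemma nf_ne_interpolates (B : Type) :
  (forall (G : ctx B) t T, nf G t T -> nf_interpolates G t T) /\
  (forall (G : ctx B) t T, ne G t T -> ne_interpolates G t T).
Proof.
  apply (nf_ne_mutind B (fun G t T _ => nf_interpolates G t T)
                        (fun G t T _ => ne_interpolates G t T)).
  - intros G Gs Gt P; do 3 eexists; split; [apply factors_Star | voc_solve].
  - intros G t u A1 A2 _ IHt _ IHu Gs Gt P.
    destruct (IHt _ _ P) as (M1 & l1 & r1 & H1 & HM1).
    destruct (IHu _ _ P) as (M2 & l2 & r2 & H2 & HM2).
    destruct (factors_join (ren_l_typed P) (ren_r_typed P) _ _ _ _ _ _ _ _ _ _ H1 H2)
      as (l0 & r1' & r2' & H1' & H2').
    do 3 eexists; split; [eapply factors_Pair; eassumption | voc_solve].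
  - intros G t A1 A2 _ IH Gs Gt P.
    (* With the bound variable in the target, its contribution $A_1^{\bar p}$ to the bound is part
       of $(A_1 \to A_2)^p$. *)
    destruct (IH _ _ (part_r _ _ _ A1 P)) as (M & l & r & H & HM).
    do 3 eexists; split; [apply factors_Lam; exact H | voc_solve].
  - intros G t A1 A2 _ IH Gs Gt P.
    destruct (IH _ _ P) as (M & l & r & H & HM).
    do 3 eexists; split; [apply factors_Inl; exact H | voc_solve].
  - intros G t A1 A2 _ IH Gs Gt P.
    destruct (IH _ _ P) as (M & l & r & H & HM).
    do 3 eexists; split; [apply factors_Inr; exact H | voc_solve].
  - intros G t A _ IH; apply nf_interpolates_ne, IH.
  - intros G t A _ IH Gs Gt P.
    (* Interpolation takes place at [Bot], whose vocabulary is empty, and [Raise] is applied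
       afterwards in the right half. *)
    destruct (nf_interpolates_ne _ _ _ IH _ _ P) as (M & l & r & H & HM).
    do 3 eexists; split; [apply factors_Raise; exact H | voc_solve].
  - intros G s bl br A1 A2 T Hs IHs _ IHl _ IHr.
    eapply nf_interpolates_Case; eauto; apply nf_ne_typed; exact Hs.
  - intros G n A H Gs Gt P.
    destruct (part_lookup P n A H) as [(m & Hm & <-)|(m & Hm & <-)].
    + left; rewrite <- ren_r_swap; apply ne_interpolates_from_Var, Hm.
    + right; apply ne_interpolates_from_Var, Hm.
  - intros G t A1 A2 _ IH Gs Gt P.
    destruct (IH _ _ P); [left | right]; eapply ne_interpolates_from_Fst; eassumption.
  - intros G t A1 A2 _ IH Gs Gt P.
    destruct (IH _ _ P); [left | right]; eapply ne_interpolates_from_Snd; eassumption.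
  - intros G t u A1 A2 _ IHt _ IHu Gs Gt P.
    destruct (IHt _ _ P); [left | right]; eapply ne_interpolates_from_App; eassumption.
Qed.

Theorem mainTheorem2 (B : Type) (G Gs Gt : ctx B) (P : ctx_partition G Gs Gt) :
  (forall (T : ty B) (t : tm), nf G t T ->
     exists (M : ty B) (l r : tm),
       typed Gs l M /\
       typed (M :: Gt) r T /\
       conv G (sub1 (ren (up_ren (ren_r P)) r) (ren (ren_l P) l)) t T /\
       (forall p : pol,
          voc p M ⊆ ctx_voc p Gs ∩ (ctx_voc (opp p) Gt ∪ voc p T)))
  /\
  (forall (T : ty B) (t : tm), ne G t T ->
     ((forall p : pol, voc p T ⊆ ctx_voc p Gs) /\
      exists (M : ty B) (l r : tm),
        typed Gt l M /\
        typed (M :: Gs) r T /\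
        conv G (sub1 (ren (up_ren (ren_l P)) r) (ren (ren_r P) l)) t T /\
        (forall p : pol, voc p M ⊆ ctx_voc (opp p) Gs ∩ ctx_voc p Gt))
     \/
     ((forall p : pol, voc p T ⊆ ctx_voc p Gt) /\
      exists (M : ty B) (l r : tm),
        typed Gs l M /\
        typed (M :: Gt) r T /\
        conv G (sub1 (ren (up_ren (ren_r P)) r) (ren (ren_l P) l)) t T /\
        (forall p : pol, voc p M ⊆ ctx_voc p Gs ∩ ctx_voc (opp p) Gt))).
Proof.
  destruct (nf_ne_interpolates B) as [Hnf Hne]; split; intros T t Ht.
  - destruct (Hnf _ _ _ Ht _ _ P) as (M & l & r & (Hl & Hr & Hc) & HM).
    exists M, l, r; rewrite sub1_ren_up; auto.
  - destruct (Hne _ _ _ Ht _ _ P)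
      as [(HT & M & l & r & (Hl & Hr & Hc) & HM)|(HT & M & l & r & (Hl & Hr & Hc) & HM)];
      [left | right]; (split; [exact HT|]); exists M, l, r; rewrite sub1_ren_up.
    (* This alternative was obtained for the swapped partition; undoing the swap exchanges the
       renamings, and the intersection is commuted. *)
    + rewrite ren_l_swap, ren_r_swap in Hc.
      split; [exact Hl | split; [exact Hr | split; [exact Hc | voc_solve]]].
    + auto.
Qed.
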